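(* For every integer $q\ge1$, $$\Delta_{\mathrm{Th}(4,q)}(-z)\doteq(1+z+\cdots+z^{q-1})\prod_{\substack{\omega^q=1\\ \omega\neq1}}\left(z^2+(2-\omega-\omega^{-1})z+1\right),$$ where the product runs over the complex $q$-th roots of unity $\omega\ne1$.
   Context: $\sigma_1,\sigma_2,\sigma_3$ are the standard generators of the braid group $B_4$, and $\mathrm{Th}(4,q)=\widehat{(\sigma_1\sigma_2^{-1}\sigma_3)^q}$ is the closure of the braid $(\sigma_1\sigma_2^{-1}\sigma_3)^q\in B_4$ (oriented as a braid closure). $\Delta$ denotes the one-variable Alexander polynomial, well defined up to multiplication by a Laurent unit $\pm t^m$, $m\in\mathbb Z$; $f\doteq g$ means equality up to such a unit (in the variable in question). For the closure $\widehat\gamma$ of a braid $\gamma\in B_4$ it is given by $$\Delta_{\widehat\gamma}(t)\doteq\frac{1-t}{1-t^4}\det\bigl(I-\overline B(\gamma)\bigr),$$ where $\overline B$ is the reduced Burau representation of $B_4$, determined by $$\overline B(\sigma_1)=\begin{pmatrix}-t&1&0\\0&1&0\\0&0&1\end{pmatrix},\quad \overline B(\sigma_2)=\begin{pmatrix}1&0&0\\t&-t&1\\0&0&1\end{pmatrix},\quad \overline B(\sigma_3)=\begin{pmatrix}1&0&0\\0&1&0\\0&t&-t\end{pmatrix}.$$ *)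

(* Defs.v *)
From mathcomp Require Import all_boot all_order all_algebra.
From mathcomp Require Import ring.
From mathcomp Require Import boolp classical_sets cardinality fsbigop.

Set Implicit Arguments.
Unset Strict Implicit.
Unset Printing Implicit Defensive.

Import GRing.Theory Num.Theory.
Local Open Scope ring_scope.

(* An element of B_4 is given by a word in the generators and their inverses:
   the letter (i, false) is sigma_(i+1), the letter (i, true) is its inverse. *)
Definition braid_word := seq ('I_3 * bool).

Definition sigma1 : braid_word := [:: (inord 0, false)].
Definition sigma2 : braid_word := [:: (inord 1, false)].
Definition sigma3 : braid_word := [:: (inord 2, false)].

Definition braid_inv (w : braid_word) : braid_word :=
  rev [seq (x.1, ~~ x.2) | x <- w].

Definition braid_exp (w : braid_word) (q : nat) : braid_word :=
  flatten (nseq q w).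

(* Equality in B_4 = < sigma_i | far commutation, braid relations >. *)
Inductive braid_eq : braid_word -> braid_word -> Prop :=
| braid_refl w : braid_eq w w
| braid_sym w1 w2 : braid_eq w1 w2 -> braid_eq w2 w1
| braid_trans w1 w2 w3 : braid_eq w1 w2 -> braid_eq w2 w3 -> braid_eq w1 w3
| braid_cat w1 w2 w3 w4 :
    braid_eq w1 w2 -> braid_eq w3 w4 -> braid_eq (w1 ++ w3) (w2 ++ w4)
| braid_cancel i b : braid_eq [:: (i, b); (i, ~~ b)] [::]
| braid_far (i j : 'I_3) : (i.+1 < j)%N ->
    braid_eq [:: (i, false); (j, false)] [:: (j, false); (i, false)]
| braid_near (i j : 'I_3) : j = i.+1 :> nat ->
    braid_eq [:: (i, false); (j, false); (i, false)]
             [:: (j, false); (i, false); (j, false)].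

Definition Th4 (q : nat) : braid_word :=
  braid_exp (sigma1 ++ braid_inv sigma2 ++ sigma3) q.

Section Burau.
Variables (K : fieldType) (t : K).

Definition mx3_of_rows (s : seq (seq K)) : 'M[K]_3 :=
  \matrix_(i, j) nth 0 (nth [::] s i) j.

Definition burau_gen (i : 'I_3) : 'M[K]_3 :=
  mx3_of_rows (nth [::]
    [:: [:: [:: - t; 1; 0]; [:: 0; 1; 0]; [:: 0; 0; 1]];
        [:: [:: 1; 0; 0]; [:: t; - t; 1]; [:: 0; 0; 1]];
        [:: [:: 1; 0; 0]; [:: 0; 1; 0]; [:: 0; t; - t]]] i).

Definition burau_letter (x : 'I_3 * bool) : 'M[K]_3 :=
  if x.2 then (burau_gen x.1)^-1 else burau_gen x.1.

Definition burau (w : braid_word) : 'M[K]_3 := \prod_(x <- w) burau_letter x.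

(* The representative of Delta_{closure of w}(t) given by the Burau formula,
   written at an arbitrary t in a field with t <> 0 and t^4 <> 1. Substitution
   of the variable is done by changing t, see alexander_closure_map. *)
Definition alexander_closure (w : braid_word) : K :=
  (1 - t) / (1 - t ^+ 4) * \det (1%:M - burau w).

Lemma ord3P (P : 'I_3 -> Prop) :
  P (inord 0) -> P (inord 1) -> P (inord 2) -> forall i, P i.
Proof.
move=> P0 P1 P2 i; rewrite -[i]inord_val.
by case: i => -[|[|[|]]].
Qed.

Lemma det_mx3 (A : 'M[K]_3) (a := fun i j => A (inord i) (inord j)) :
  \det A = a 0 0 * (a 1 1 * a 2 2 - a 1 2 * a 2 1)
         - a 0 1 * (a 1 0 * a 2 2 - a 1 2 * a 2 0)
         + a 0 2 * (a 1 0 * a 2 1 - a 1 1 * a 2 0) :> K.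
Proof.
rewrite (expand_det_row _ ord0) !big_ord_recl big_ord0 /cofactor.
rewrite !(expand_det_row _ ord0) !big_ord_recl !big_ord0 /cofactor.
rewrite !det_mx11 !mxE /=.
have E (i j : 'I_3) : A i j = a i j by rewrite /a !inord_val.
rewrite !E /= /bump /=.
rewrite ?(exprS, expr0); ring.
Qed.

Lemma det_burau_gen i : \det (burau_gen i) = - t.
Proof.
by elim/ord3P: i; rewrite det_mx3 !mxE !inordK //=; ring.
Qed.

Lemma burau_cat w1 w2 : burau (w1 ++ w2) = burau w1 * burau w2.
Proof. by rewrite /burau big_cat. Qed.

Lemma burau_exp w q : burau (braid_exp w q) = burau w ^+ q.
Proof.
elim: q => [|q IH]; first by rewrite /burau /braid_exp big_nil.
by rewrite /braid_exp /= burau_cat IH exprS.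
Qed.

Lemma burau_braid_eq w1 w2 : t != 0 -> braid_eq w1 w2 -> burau w1 = burau w2.
Proof.
move=> t0.
have U i : burau_gen i \is a GRing.unit.
  by rewrite -[_ \is a _]/(_ \in unitmx) unitmxE det_burau_gen unitfE oppr_eq0.
elim=> // {w1 w2}.
- by move=> w1 w2 w3 _ -> _ ->.
- by move=> w1 w2 w3 w4 _ H _ H'; rewrite !burau_cat H H'.
- move=> i b; rewrite /burau !big_cons big_nil mulr1 /burau_letter /=.
  by case: b; rewrite /= ?mulVr ?mulrV.
- move=> i j; rewrite /burau !big_cons big_nil !mulr1 /burau_letter /=.
  elim/ord3P: i; elim/ord3P: j; rewrite !inordK //= => _.
  apply/matrixP; elim/ord3P; elim/ord3P;
    rewrite !mxE !big_ord_recl !big_ord0 !mxE !inordK //=; ring.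
- move=> i j; rewrite /burau !big_cons big_nil !mulr1 /burau_letter /=.
  elim/ord3P: i; elim/ord3P: j; rewrite !inordK //= => _.
    apply/matrixP; elim/ord3P; elim/ord3P;
    do 4! rewrite ?mxE ?big_ord_recl ?big_ord0; rewrite !inordK //=; ring.
  apply/matrixP; elim/ord3P; elim/ord3P;
    do 4! rewrite ?mxE ?big_ord_recl ?big_ord0; rewrite !inordK //=; ring.
Qed.

Lemma alexander_closure_braid_eq w1 w2 : t != 0 ->
  braid_eq w1 w2 -> alexander_closure w1 = alexander_closure w2.
Proof. by move=> t0 H; rewrite /alexander_closure (burau_braid_eq t0 H). Qed.

End Burau.

Lemma alexander_closure_map (K L : fieldType) (f : {rmorphism K -> L}) (t : K)
    (w : braid_word) :
  f (alexander_closure t w) = alexander_closure (f t) w.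
Proof.
have gE i : map_mx f (burau_gen t i) = burau_gen (f t) i.
  elim/ord3P: i; apply/matrixP; elim/ord3P; elim/ord3P;
  by rewrite !mxE !inordK //= ?rmorphN ?rmorph0 ?rmorph1.
have bE : map_mx f (burau t w) = burau (f t) w.
  rewrite /burau; elim: w => [|[i b] w IH]; first by rewrite !big_nil map_mx1.
  rewrite !big_cons map_mxM IH /burau_letter /=.
  by case: b; rewrite /= ?gE // map_invmx gE.
rewrite /alexander_closure rmorphM fmorph_div !rmorphB rmorphXn rmorph1.
by rewrite -det_map_mx map_mxB map_mx1 bE.
Qed.

(* Equality of rational functions (in particular of Laurent polynomials) up to
   a unit +- z^m, m in Z. *)
Definition doteq (K : fieldType) (z f g : K) : Prop :=
  exists (e : bool) (m : int), f = (-1) ^+ e * z ^ m * g.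

(* Main.v *)
Require Import Defs.
From mathcomp Require Import all_boot all_order all_algebra.
From mathcomp Require Import boolp classical_sets cardinality fsbigop.
From mathcomp Require Import separable cyclotomic ring.

Import GRing.Theory Num.Theory.
Local Open Scope classical_set_scope.
Local Open Scope ring_scope.

(** Let M be the reduced Burau matrix of sigma1 sigma2^-1 sigma3, so that the
    matrix of the q-th power of this braid is M ^+ q. Splitting X^q - 1 into the
    factors X - w, for w a q-th root of unity, and evaluating at M gives
      det (M ^+ q - 1) = \prod_w det (M - w),
    so everything reduces to the characteristic polynomial of the single 3 x 3
    matrix M (det_burau_Th4_1_sub). At t = - z it has the root z, and its
    cofactor is the palindromic quadratic w^2 - (z + 2 + z^-1) w + 1, which is
    - w / z times z^2 + (2 - w - w^-1) z + 1: the roles of w and z in the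
    quadratic are exchanged at the cost of a unit. Over all w, the linear
    factors z - w multiply to z^q - 1 and the factors - w to 0^q - 1 = - 1, so
    that (det_burau_Th4_sub1)
      det (1 - M ^+ q) = z^-q (z^q - 1) \prod_w (z^2 + (2 - w - w^-1) z + 1).
    The root w = 1 contributes z^2 + 1, and
      (1 + z) / (1 - z^4) = - 1 / ((z - 1) (z^2 + 1))
    cancels this factor and turns z^q - 1 into - (1 + z + ... + z^(q-1)). The
    Laurent unit relating the two sides is therefore - z^-q.

    The computation is made in an arbitrary field over which X^q - 1 splits
    (alexander_closure_Th4); it is then specialised to C(z), where the
    splitting comes from C. *)

(** Evaluation at A and the determinant are both multiplicative. *)
Lemma det_horner_mx_prod (R : comNzRingType) (n : nat) (A : 'M[R]_n.+1)
    (rs : seq R) :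
  \det (horner_mx A (\prod_(r <- rs) ('X - r%:P))) =
  \prod_(r <- rs) \det (A - r%:M).
Proof.
elim: rs => [|r rs IH]; first by rewrite !big_nil rmorph1 det1.
by rewrite !big_cons rmorphM detM IH rmorphB /= horner_mx_X horner_mx_C.
Qed.

Lemma burau_gen1_inv (K : fieldType) (t : K) : t != 0 ->
  (burau_gen t (inord 1))^-1 =
  mx3_of_rows [:: [:: 1; 0; 0]; [:: 1; - t^-1; t^-1]; [:: 0; 0; 1]].
Proof.
move=> t0; set B := RHS.
have BV : burau_gen t (inord 1) * B = 1.
  apply/matrixP; elim/ord3P; elim/ord3P;
    rewrite !mxE !big_ord_recl big_ord0 !mxE -?val_eqE /= !inordK //=; by field.
have U : burau_gen t (inord 1) \is a GRing.unit.
  by rewrite -[_ \is a _]/(_ \in unitmx) unitmxE det_burau_gen unitfE oppr_eq0.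
by rewrite -[LHS]mulr1 -BV mulKr.
Qed.

Lemma burau_Th4_1 (K : fieldType) (t : K) : t != 0 ->
  burau t (sigma1 ++ braid_inv sigma2 ++ sigma3) =
  mx3_of_rows [:: [:: 1 - t; 1 - t^-1; - 1];
                  [:: 1; 1 - t^-1; - 1];
                  [:: 0; t; - t]].
Proof.
move=> t0; rewrite /burau !big_cons big_nil mulr1 /burau_letter /=.
rewrite burau_gen1_inv //.
apply/matrixP; elim/ord3P; elim/ord3P;
  do 4! rewrite ?mxE ?big_ord_recl ?big_ord0; rewrite !inordK //=; by field.
Qed.

(** The factorisation, up to sign, of the characteristic polynomial of the
    matrix of sigma1 sigma2^-1 sigma3: one eigenvalue is - t, and the other two
    are inverse to each other. *)
Lemma det_burau_Th4_1_sub (K : fieldType) (t a : K) : t != 0 ->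
  \det (burau t (sigma1 ++ braid_inv sigma2 ++ sigma3) - a%:M) =
  - (t + a) * (a ^+ 2 - (2 - t - t^-1) * a + 1).
Proof.
move=> t0; rewrite burau_Th4_1 // det_mx3 !mxE -!val_eqE /= !inordK //=.
by field.
Qed.

(** The product over the roots r of X^q - 1 of the characteristic values
    det (M - r), each written as (z - r) (- r) z^-1 times the quadratic. The
    first two factors are the values at z and at 0 of a - r, whose product over
    all r is a^q - 1. *)
Lemma det_burau_Th4_sub1 (K : fieldType) (z : K) (q : nat) (rs : seq K) :
    z != 0 -> (0 < q)%N ->
    'X^q - 1 = \prod_(r <- rs) ('X - r%:P) ->
  \det (1%:M - burau (- z) (Th4 q)) =
  z ^- q * (z ^+ q - 1) * \prod_(r <- rs) (z ^+ 2 + (2 - r - r^-1) * z + 1).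
Proof.
move=> z0 q0 Xq1.
have horner_Xq1 a : a ^+ q - 1 = \prod_(r <- rs) (a - r).
  have := congr1 (fun p => p.[a]) Xq1.
  rewrite !hornerE horner_prod => ->.
  by apply: eq_bigr => r _; rewrite !hornerE.
have size_rs : size rs = q.
  by apply/succn_inj; rewrite -(size_prod_XsubC rs id) -Xq1 size_XnsubC.
(* 0 - r rather than - r, so that horner_Xq1 applies to this factor too. *)
have factor r : r \in rs ->
    \det (burau (- z) (sigma1 ++ braid_inv sigma2 ++ sigma3) - r%:M) =
    (z - r) * (0 - r) * z^-1 * (z ^+ 2 + (2 - r - r^-1) * z + 1).
  move=> r_rs; have r0 : r != 0.
    apply/eqP => r0; have := horner_Xq1 r.
    rewrite (big_rem r) //= subrr mul0r r0 expr0n eqn0Ngt q0 sub0r.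
    by move/eqP; rewrite oppr_eq0 oner_eq0.
  rewrite det_burau_Th4_1_sub ?oppr_eq0 //.
  by field; rewrite oppr_eq0 z0 r0.
rewrite -opprB -scaleN1r detZ burau_exp.
set M := burau _ _.
have -> : M ^+ q - 1%:M = horner_mx M ('X^q - 1).
  by rewrite rmorphB (rmorph1 (horner_mx M)) rmorphXn /= horner_mx_X.
rewrite Xq1 det_horner_mx_prod (eq_big_seq _ factor) !big_split /=.
rewrite -!horner_Xq1 big_const_seq count_predT size_rs iter_mulr_1.
rewrite expr0n eqn0Ngt q0 exprVn /=; ring.
Qed.

(** The root 1 is put in front because its factor cancels; distinctness of the
    roots, by separability of X^n - 1 in characteristic 0, is what allows a
    product over this list to be read as one over the set of roots of unity. *)
Lemma Xn_sub1_split (C : numClosedFieldType) (n : nat) : (0 < n)%N ->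
  exists2 rs : seq C, uniq (1 :: rs) &
    'X^n - 1 = \prod_(r <- 1 :: rs) ('X - r%:P).
Proof.
move=> n0; have [rs] := closed_field_poly_normal ('X^n - 1 : {poly C}).
rewrite (monicP (monicXnsubC _ n0)) scale1r => Dp.
have uniq_rs : uniq rs.
  by rewrite -separable_prod_XsubC -Dp separable_Xn_sub_1 // pnatr_eq0 -lt0n.
have rs1 : 1 \in rs.
  by rewrite -root_prod_XsubC -Dp rootE !hornerE expr1n subrr.
have rs_perm := perm_to_rem rs1.
exists (rem 1 rs); first by rewrite -(perm_uniq rs_perm).
by rewrite Dp (perm_big _ rs_perm).
Qed.

(** Carries the splitting of X^n - 1 from C to the field C(z) over which the
    Burau matrices are taken. *)
Lemma map_Xn_sub1_split (F L : fieldType) (f : {rmorphism F -> L}) (n : nat)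
    (rs : seq F) :
  'X^n - 1 = \prod_(r <- rs) ('X - r%:P) ->
  'X^n - 1 = \prod_(r <- map f rs) ('X - r%:P).
Proof.
move/(congr1 (map_poly f)); rewrite rmorphB rmorph1 /= map_polyXn => ->.
by rewrite rmorph_prod big_map; apply: eq_bigr => r _; apply: map_polyXsubC.
Qed.

(** The factor of the root 1 is z^2 + 1; together with the z - 1 that divides
    z^q - 1 it absorbs (1 + z) / (1 - z^4). *)
Lemma alexander_closure_Th4 (K : fieldType) (z : K) (q : nat) (rs : seq K) :
    z != 0 -> z ^+ 4 != 1 -> (0 < q)%N ->
    'X^q - 1 = \prod_(r <- 1 :: rs) ('X - r%:P) ->
  alexander_closure (- z) (Th4 q) =
  (-1) ^+ true * z ^ (- q%:Z) *
  ((\sum_(0 <= i < q) z ^+ i) *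
   \prod_(r <- rs) (z ^+ 2 + (2 - r - r^-1) * z + 1)).
Proof.
move=> z0 z4 q0 Xq1.
have t4 : 1 - (- z) ^+ 4 != 0.
  by have -> : 1 - (- z) ^+ 4 = - (z ^+ 4 - 1); [ring | rewrite oppr_eq0 subr_eq0].
rewrite /alexander_closure (det_burau_Th4_sub1 _ _ _ _ z0 q0 Xq1) big_cons.
rewrite subrX1 big_mkord -exprnN expr1 invr1.
set P := \prod_(r <- _) _; set S := \sum_(i < q) _; set Q := z ^- q.
by field.
Qed.

Theorem proposition3p2 (C : numClosedFieldType) (q : nat) (hq : (1 <= q)%N) :
  let z : {fraction {poly C}} := tofrac 'X in
  doteq z
    (alexander_closure (- z) (Th4 q))
    (tofrac ((\sum_(0 <= i < q) 'X^i) *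
             \big[*%R/1]_(w \in [set w : C | w ^+ q = 1 /\ w <> 1])
                ('X^2 + (2 - w - w^-1) *: 'X + 1))).
Proof.
move=> z; have [rs uniq_rs Xq1] := Xn_sub1_split C q hq.
have -> : [set w : C | w ^+ q = 1 /\ w <> 1] = [set` rs].
  have mem_rs w : (w \in 1 :: rs) = (w ^+ q == 1).
    by rewrite -root_prod_XsubC -Xq1 rootE !hornerE subr_eq0.
  apply/seteqP; split=> w /=.
    by case=> /eqP; rewrite -mem_rs inE => /predU1P[].
  move=> w_rs; split; first by apply/eqP; rewrite -mem_rs inE w_rs orbT.
  by move=> w1; move: uniq_rs; rewrite -w1 /= w_rs.
rewrite -fsbig_seq; last by case/andP: uniq_rs.
have [f fE] : exists f : {rmorphism C -> {fraction {poly C}}},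
    forall c, f c = tofrac c%:P.
  by exists [the {rmorphism _ -> _} of @tofrac {poly C} \o polyC].
have z0 : z != 0 by rewrite tofrac_eq0 polyX_eq0.
have z4 : z ^+ 4 != 1.
  rewrite -tofrac1 -tofracXn tofrac_eq -subr_eq0.
  by rewrite (monic_neq0 (monicXnsubC _ _)).
have Xq1K := map_Xn_sub1_split _ _ f _ _ Xq1.
rewrite /= rmorph1 in Xq1K.
exists true, (- q%:Z).
rewrite (alexander_closure_Th4 _ _ _ _ z0 z4 hq Xq1K) big_map.
congr (_ * _); rewrite tofracM; congr (_ * _).
  by rewrite rmorph_sum /=; apply: eq_bigr => i _; rewrite tofracXn.
rewrite rmorph_prod /=; apply: eq_bigr => r _.
by rewrite -fmorphV -[2](rmorph_nat f) -!rmorphB fE -mul_polyC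
  !tofracD tofracXn tofracM tofrac1.
Qed.
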